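(* $\mathsf{RC}\equiv_{sW}\mathsf D\equiv_{sW}\mathsf{WF}$.
   Context: $\equiv_{sW}$ denotes strong Weihrauch equivalence. Graphs are countable, given by vertex and edge sets. A coloring of a graph $G$ with vertex set $V$ is a map $c:V\to\mathbb N$ with $c(v_1)\ne c(v_2)$ whenever $(v_1,v_2)$ is an edge. $\mathsf{RC}$: given a graph $G$, output $1$ if there is a coloring of $G$ that uses one color infinitely often and $0$ otherwise. $\mathsf D$: given a graph $G$, output $1$ if $G$ has an infinite completely disconnected subgraph (an infinite set of vertices, no two of which are joined by an edge of $G$) and $0$ otherwise. $\mathsf{WF}$: given a tree $T\subseteq\mathbb N^{<\mathbb N}$, output $0$ if $T$ contains an infinite path and $1$ if not. *)

(* Defs.v *)
From mathcomp Require Import all_boot.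
From mathcomp Require Import boolp classical_sets cardinality.

Set Implicit Arguments.
Unset Strict Implicit.
Unset Printing Implicit Defensive.

Local Open Scope classical_set_scope.

Definition baire : Type := nat -> nat.

(* Kleene's mu-recursive functions with an oracle for a point of Baire space.
   Codes carry no arity: arguments missing from the list are read as 0. *)
Inductive code : Type :=
| Zero
| Succ
| Proj of nat
| Oracle
| Comp of code & seq code
| PrimRec of code & code
| Mu of code.

(* [eval p e xs y]: the code e, with oracle p, halts on the arguments xs with
   value y.  In the PrimRec case r is the sequence of intermediate values. *)
Fixpoint eval (p : baire) (e : code) (xs : seq nat) (y : nat) {struct e} :
    Prop :=
  match e with
  | Zero => y = 0
  | Succ => y = (nth 0 xs 0).+1
  | Proj i => y = nth 0 xs i
  | Oracle => y = p (nth 0 xs 0)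
  | Comp f gs =>
      exists2 ys : seq nat,
        (fix evals (gs : seq code) (ys : seq nat) {struct gs} : Prop :=
           match gs, ys with
           | [::], [::] => True
           | g :: gs', z :: ys' => eval p g xs z /\ evals gs' ys'
           | _, _ => False
           end) gs ys
        & eval p f ys y
  | PrimRec f g =>
      exists r : nat -> nat,
        [/\ eval p f (behead xs) (r 0),
            forall i, i < nth 0 xs 0 ->
              eval p g (i :: r i :: behead xs) (r i.+1)
          & y = r (nth 0 xs 0)]
  | Mu f =>
      eval p f (y :: xs) 0 /\
      forall i, i < y -> exists z, eval p f (i :: xs) z.+1
  end.

(* Partial functions on Baire space; [None] means undefined. *)
Definition pfun : Type := baire -> option baire.

Definition pcomp (G F : pfun) : pfun := fun p => obind G (F p).

(* Type-two computability: one code computes the values of F on its domain. *)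
Definition computable (F : pfun) : Prop :=
  exists e : code, forall p q : baire,
    F p = Some q -> forall n, eval p e [:: n] (q n).

(* A representation is a partial surjection from Baire space, given by its
   graph: [names p x] says that p is a name of x. *)
Record repSpace : Type := RepSpace {
  rep_sort :> Type;
  names : baire -> rep_sort -> Prop;
  names_fun : forall p x y, names p x -> names p y -> x = y;
  names_surj : forall x, exists p, names p x }.

(* Problems are partial multi-valued functions; the domain consists of the
   instances that have a solution. *)
Definition problem (X Y : repSpace) : Type := X -> Y -> Prop.

Definition pdom (X Y : repSpace) (f : problem X Y) (x : X) : Prop :=
  exists y, f x y.

Definition realizes (X Y : repSpace) (F : pfun) (f : problem X Y) : Prop :=
  forall p x, names p x -> pdom f x ->
    exists q, F p = Some q /\ exists2 y, names q y & f x y.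

Definition le_sW (X Y Z W : repSpace) (f : problem X Y) (g : problem Z W) :
    Prop :=
  exists H K : pfun, [/\ computable H, computable K &
    forall G : pfun, realizes G g -> realizes (pcomp K (pcomp G H)) f].

Definition equiv_sW (X Y Z W : repSpace) (f : problem X Y) (g : problem Z W) :
    Prop :=
  le_sW f g /\ le_sW g f.

Definition problem_of (X Y : repSpace) (f : X -> Y) : problem X Y :=
  fun x y => y = f x.

(* Countable simple undirected graphs with vertices in nat; the vertex set may
   be finite or empty. *)
Record graph : Type := Graph {
  vert : pred nat;
  edge : rel nat;
  edge_vert : forall u v, edge u v -> vert u && vert v;
  edge_sym : symmetric edge;
  edge_irr : irreflexive edge }.

(* Trees in N^{<N}: sets of finite sequences closed under initial segments
   (the empty set included). *)
Record tree : Type := Tree {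
  node : pred (seq nat);
  node_prefix : forall s t, prefix s t -> node t -> node s }.

(* Finite sequences, and pairs as sequences of length 2, are numbered by
   CodeSeq.code, a computable bijection from seq nat to nat.  A name of a graph
   is the join of the characteristic functions of its vertex and edge sets
   (values at odd places that do not code a pair are irrelevant). *)
Definition graph_names (p : baire) (G : graph) : Prop :=
  (forall v, p v.*2 = vert G v) /\
  (forall u v, p (CodeSeq.code [:: u; v]).*2.+1 = edge G u v).

Definition tree_names (p : baire) (T : tree) : Prop :=
  forall s, p (CodeSeq.code s) = node T s.

Definition bool_names (p : baire) (b : bool) : Prop := p 0 = b.

Lemma nat_of_bool_inj : injective nat_of_bool.
Proof. by case; case. Qed.

Lemma graph_names_fun p G H : graph_names p G -> graph_names p H -> G = H.
Proof.
case: G H => [V E a b c] [V' E' a' b' c'] [/= hV hE] [/= hV' hE'].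
have eV : V = V' by apply/funext => v; apply: nat_of_bool_inj; rewrite -hV -hV'.
have eE : E = E'.
  apply/funext => u; apply/funext => v.
  by apply: nat_of_bool_inj; rewrite -hE -hE'.
subst V' E'; congr Graph; exact: Prop_irrelevance.
Qed.

Lemma graph_names_surj G : exists p, graph_names p G.
Proof.
exists (fun n => if odd n then
    let s := CodeSeq.decode n./2 in nat_of_bool (edge G (nth 0 s 0) (nth 0 s 1))
  else nat_of_bool (vert G n./2)).
split=> [v|u v]; first by rewrite odd_double doubleK.
have hc := CodeSeq.codeK [:: u; v].
by set c := CodeSeq.code _ in hc *; rewrite oddS odd_double /= uphalf_double hc.
Qed.

Lemma tree_names_fun p T U : tree_names p T -> tree_names p U -> T = U.
Proof.
case: T U => [A a] [B b] /= hA hB.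
have eAB : A = B.
  by apply/funext => s; apply: nat_of_bool_inj; rewrite -hA -hB.
subst B; congr Tree; exact: Prop_irrelevance.
Qed.

Lemma tree_names_surj T : exists p, tree_names p T.
Proof.
exists (fun n => nat_of_bool (node T (CodeSeq.decode n))) => s.
by rewrite CodeSeq.codeK.
Qed.

Lemma bool_names_fun p b c : bool_names p b -> bool_names p c -> b = c.
Proof. by rewrite /bool_names => hb hc; apply: nat_of_bool_inj; rewrite -hb. Qed.

Lemma bool_names_surj b : exists p, bool_names p b.
Proof. by exists (fun=> nat_of_bool b). Qed.

Definition graphRep : repSpace := RepSpace graph_names_fun graph_names_surj.
Definition treeRep : repSpace := RepSpace tree_names_fun tree_names_surj.
Definition boolRep : repSpace := RepSpace bool_names_fun bool_names_surj.

(* Only the values of c on the vertex set matter. *)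
Definition coloring (G : graph) (c : nat -> nat) : Prop :=
  forall u v, edge G u v -> c u <> c v.

(* The outputs 1 and 0 are [true] and [false]. *)
Definition RC : problem graphRep boolRep :=
  problem_of (X := graphRep) (Y := boolRep) (fun G : graph =>
    `[< exists2 c, coloring G c
        & exists k, infinite_set [set v | vert G v /\ c v = k] >]).

Definition D : problem graphRep boolRep :=
  problem_of (X := graphRep) (Y := boolRep) (fun G : graph =>
    `[< exists S : set nat, [/\ infinite_set S, S `<=` [set v | vert G v]
        & forall u v, S u -> S v -> u <> v -> ~~ edge G u v] >]).

Definition WF : problem treeRep boolRep :=
  problem_of (X := treeRep) (Y := boolRep) (fun T : tree =>
    ~~ `[< exists f : nat -> nat, forall n, node T (mkseq f n) >]).

(* Main.v *)
(* An infinite independent set is the same as a coloring with an infinite color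
   class: give the set one color and all other vertices pairwise distinct
   colors.  Hence RC and D are the same function.  The increasing enumerations
   of independent sets of G form a tree whose infinite paths are the infinite
   independent sets of G.  Conversely, joining incomparable nodes of a tree
   yields a graph whose infinite independent sets are the infinite chains of
   the tree, each of which determines an infinite path. *)
From mathcomp Require Import all_boot.
From mathcomp Require Import boolp classical_sets cardinality.
Require Import Defs.

Set Implicit Arguments.
Unset Strict Implicit.
Unset Printing Implicit Defensive.

Local Open Scope classical_set_scope.

(** * Computable functionals *)

(** This replaces the anonymous inner fixpoint of [eval] by a condition on each index, so that later
    codes can be checked entry by entry. *)
Lemma eval_Comp p f gs xs ys y : size gs = size ys ->
  (forall i, i < size gs -> eval p (nth Zero gs i) xs (nth 0 ys i)) ->
  eval p f ys y -> eval p (Comp f gs) xs y.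
Proof.
move=> eq_sz evg evf /=; exists ys => //.
elim: gs ys eq_sz evg {evf} => [|g gs IH] [|z ys] //= [eq_sz] evg.
by split; [exact: (evg 0) | apply: IH => // i; exact: (evg i.+1)].
Qed.

(* Arguments are read from an infinite environment, so that going under a binder
   is a shift of the environment, which holds by conversion.  The code may
   depend on the number k of arguments, since a code cannot copy an argument
   list of unknown length. *)
Definition cpt (F : baire -> (nat -> nat) -> nat) : Prop :=
  forall k, exists e, forall p xs, size xs = k -> eval p e xs (F p (nth 0 xs)).

Lemma cpt_computable H : cpt (fun p x => H p (x 0)) ->
  computable (fun p => Some (H p)).
Proof. by move=> /(_ 1)[e ev]; exists e => p q [<-] n; apply: (ev p [:: n]). Qed.

Lemma eq_cpt F F' : (forall p x, F p x = F' p x) -> cpt F -> cpt F'.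
Proof.
by move=> eqF + k => /(_ k)[e ev]; exists e => p xs; rewrite -eqF; exact: ev.
Qed.

Lemma cpt_var i : cpt (fun p x => x i).
Proof. by move=> k; exists (Proj i). Qed.

(** A loop body sees a shifted environment, in which an arbitrary [G] is not directly at hand.
    Substituting [G] afterwards lets a loop be built for the variable [x 0], which merely shifts to
    [x 2]. *)
Lemma cpt_comp1 f G : cpt (fun p x => f p (x 0)) -> cpt G ->
  cpt (fun p x => f p (G p x)).
Proof.
move=> /(_ 1)[ef evf] cG k; have [eG evG] := cG k.
exists (Comp ef [:: eG]) => p xs szx.
apply: (@eval_Comp _ _ _ _ [:: G p (nth 0 xs)]) => // [[|//] _|]; first exact: evG.
exact: evf.
Qed.

Lemma cpt_comp2 f G1 G2 : cpt (fun p x => f p (x 0) (x 1)) -> cpt G1 -> cpt G2 ->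
  cpt (fun p x => f p (G1 p x) (G2 p x)).
Proof.
move=> /(_ 2)[ef evf] c1 c2 k; have [e1 ev1] := c1 k; have [e2 ev2] := c2 k.
exists (Comp ef [:: e1; e2]) => p xs szx.
apply: (@eval_Comp _ _ _ _ [:: G1 p (nth 0 xs); G2 p (nth 0 xs)]) => //; last exact: evf.
by move=> [_|[_|//]]; [exact: ev1 | exact: ev2].
Qed.

Lemma cpt_oracle G : cpt G -> cpt (fun p x => p (G p x)).
Proof. by apply: (@cpt_comp1 (fun p => p)) => k; exists Oracle. Qed.

Lemma cpt_succ G : cpt G -> cpt (fun p x => (G p x).+1).
Proof. by apply: (@cpt_comp1 (fun _ n => n.+1)) => k; exists Succ. Qed.

Lemma cpt_const c : cpt (fun p x => c).
Proof.
elim: c => [|c IH]; last exact: cpt_succ.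
by move=> k; exists Zero.
Qed.

Lemma cpt_iteri A B N : cpt A ->
  cpt (fun p x => B p (fun j => x j.+2) (x 0) (x 1)) -> cpt N ->
  cpt (fun p x => iteri (N p x) (fun i r => B p x i r) (A p x)).
Proof.
move=> cA cB cN k.
have [eA evA] := cA k; have [eB evB] := cB k.+2; have [eN evN] := cN k.
(* [PrimRec] takes its counter as first argument, so the value of [N] is put in front of the
   arguments, which the [k] projections copy. *)
exists (Comp (PrimRec eA eB) (eN :: map Proj (iota 0 k))) => p xs szx.
apply: (@eval_Comp _ _ _ _ (N p (nth 0 xs) :: xs)) => /=.
- by rewrite size_map size_iota szx.
- case=> [_|i]; first exact: evN.
  rewrite /= ltnS size_map size_iota => ltik.
  by rewrite (nth_map 0) ?size_iota //= nth_iota.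
exists (fun n => iteri n (B p (nth 0 xs)) (A p (nth 0 xs))); split=> //.
  exact: evA.
by move=> i _; apply: (evB p [:: i, _ & xs]); rewrite /= szx.
Qed.

Lemma cpt_pred G : cpt G -> cpt (fun p x => (G p x).-1).
Proof.
apply: (@cpt_comp1 (fun _ n => n.-1)).
(* The last round of the loop returns its own index, which is the predecessor. *)
apply: (@eq_cpt (fun p x => iteri (x 0) (fun i _ => i) 0)); first by move=> p x; case: (x 0).
by apply: cpt_iteri; [exact: cpt_const | exact: cpt_var | exact: cpt_var].
Qed.

Lemma cpt_add F G : cpt F -> cpt G -> cpt (fun p x => F p x + G p x).
Proof.
move=> cF cG; apply: (@eq_cpt (fun p x => iteri (G p x) (fun _ r => r.+1) (F p x))).
  by move=> p x; elim: (G p x) => [|n /= ->]; rewrite ?addn0 ?addnS.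
by apply: cpt_iteri => //; apply/cpt_succ/cpt_var.
Qed.

Lemma cpt_sub F G : cpt F -> cpt G -> cpt (fun p x => F p x - G p x).
Proof.
move=> cF cG; apply: (@eq_cpt (fun p x => iteri (G p x) (fun _ r => r.-1) (F p x))).
  by move=> p x; elim: (G p x) => [|n /= ->]; rewrite ?subn0 ?subnS.
by apply: cpt_iteri => //; apply/cpt_pred/cpt_var.
Qed.

Lemma cpt_mul F G : cpt F -> cpt G -> cpt (fun p x => F p x * G p x).
Proof.
apply: (@cpt_comp2 (fun _ => muln)).
apply: (@eq_cpt (fun p x => iteri (x 1) (fun _ r => r + x 0) 0)).
  by move=> p x; elim: (x 1) => [|n /= ->]; rewrite ?muln0 ?mulnSr.
apply: cpt_iteri; [exact: cpt_const | | exact: cpt_var].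
by apply: cpt_add; exact: cpt_var.
Qed.

Lemma cpt_double G : cpt G -> cpt (fun p x => (G p x).*2).
Proof.
move=> cG; apply: (@eq_cpt (fun p x => G p x + G p x)) => [p x|]; first exact: addnn.
exact: cpt_add.
Qed.

Lemma cpt_exp2 G : cpt G -> cpt (fun p x => 2 ^ G p x).
Proof.
move=> cG; apply: (@eq_cpt (fun p x => iteri (G p x) (fun _ r => r.*2) 1)).
  by move=> p x; elim: (G p x) => //= n ->; rewrite expnS mul2n.
by apply: cpt_iteri => //; [exact: cpt_const | apply/cpt_double/cpt_var].
Qed.

Lemma cpt_half G : cpt G -> cpt (fun p x => (G p x)./2).
Proof.
(* The recursion works because [i - i./2] is the half of [i.+1]. *)
move=> cG; apply: (@eq_cpt (fun p x => iteri (G p x) (fun i r => i - r) 0)).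
  move=> p x; elim: (G p x) => //= n ->.
  by rewrite uphalf_half -[X in X - _]odd_double_half -addnn addnA addnK.
by apply: cpt_iteri => //; [exact: cpt_const | apply: cpt_sub; exact: cpt_var].
Qed.

Lemma cpt_divn_exp2 F G : cpt F -> cpt G -> cpt (fun p x => F p x %/ 2 ^ G p x).
Proof.
move=> cF cG; apply: (@eq_cpt (fun p x => iteri (G p x) (fun _ r => r./2) (F p x))).
  move=> p x; elim: (G p x) => [|n /= ->]; first by rewrite divn1.
  by rewrite expnSr divnMA divn2.
by apply: cpt_iteri => //; apply/cpt_half/cpt_var.
Qed.

Lemma cpt_odd G : cpt G -> cpt (fun p x => odd (G p x)).
Proof.
move=> cG; apply: (@eq_cpt (fun p x => G p x - (G p x)./2.*2)).
  by move=> p x; rewrite -[X in X - _]odd_double_half addnK.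
by apply: cpt_sub => //; apply/cpt_double/cpt_half.
Qed.

Lemma cpt_negb (B : baire -> (nat -> nat) -> bool) :
  cpt (fun p x => B p x) -> cpt (fun p x => ~~ B p x).
Proof.
move=> cB; apply: (@eq_cpt (fun p x => 1 - B p x)) => [p x|]; first by case: (B p x).
by apply: cpt_sub => //; exact: cpt_const.
Qed.

Lemma cpt_and (B C : baire -> (nat -> nat) -> bool) :
  cpt (fun p x => B p x) -> cpt (fun p x => C p x) ->
  cpt (fun p x => B p x && C p x).
Proof.
move=> cB cC; apply: (@eq_cpt (fun p x => B p x * C p x)); last exact: cpt_mul.
by move=> p x; rewrite mulnb.
Qed.

Lemma cpt_implyb (B C : baire -> (nat -> nat) -> bool) :
  cpt (fun p x => B p x) -> cpt (fun p x => C p x) ->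
  cpt (fun p x => B p x ==> C p x).
Proof.
move=> cB cC; apply: (@eq_cpt (fun p x => ~~ (B p x && ~~ C p x))).
  by move=> p x; rewrite negb_and negbK implybE.
by apply: cpt_negb; apply: cpt_and => //; exact: cpt_negb.
Qed.

Lemma cpt_leq F G : cpt F -> cpt G -> cpt (fun p x => F p x <= G p x).
Proof.
move=> cF cG; apply: (@eq_cpt (fun p x => 1 - (F p x - G p x))).
  by move=> p x; rewrite leqNgt -subn_gt0; case: (F p x - G p x).
by apply: cpt_sub; [exact: cpt_const | exact: cpt_sub].
Qed.

Lemma cpt_eqn F G : cpt F -> cpt G -> cpt (fun p x => F p x == G p x).
Proof.
move=> cF cG; apply: (@eq_cpt (fun p x => (F p x <= G p x) && (G p x <= F p x))).
  by move=> p x; rewrite eqn_leq.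
by apply: cpt_and; exact: cpt_leq.
Qed.

(* The environment below the bound variable is shifted by two, as in
   [cpt_iteri]; [x 1] is an unused accumulator. *)
Lemma cpt_all (B : baire -> (nat -> nat) -> nat -> bool) N :
  cpt (fun p x => B p (fun j => x j.+2) (x 0)) -> cpt N ->
  cpt (fun p x => all (fun i => B p x i) (iota 0 (N p x))).
Proof.
move=> cB cN.
apply: (@eq_cpt (fun p x => iteri (N p x) (fun i r => r * B p x i) 1)).
  move=> p x; elim: (N p x) => // n IH.
  by rewrite -[n.+1 in RHS]addn1 iotaD all_cat /= IH mulnb andbT.
by apply: cpt_iteri; [exact: cpt_const | apply: cpt_mul (cpt_var 1) cB |].
Qed.

(** * Computing with codes of sequences *)

Lemma code_ind (P : nat -> Prop) :
  (forall s, P (CodeSeq.code s)) -> forall n, P n.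
Proof. by move=> Pc n; rewrite -[n]CodeSeq.decodeK. Qed.

Lemma code_eq0 s : (CodeSeq.code s == 0) = (s == [::]).
Proof. by case: s => //= v s; rewrite muln_eq0 expn_eq0. Qed.

Lemma size_le_code s : size s <= CodeSeq.code s.
Proof.
elim: s => //= v s IH; rewrite -[_.+1]mul1n leq_mul ?expn_gt0 // ltnS.
by rewrite -addnn (leq_trans IH) ?leq_addr.
Qed.

(** The code of [v :: s] is [2 ^ v] times an odd number, so the head is an exponent of 2. The loop
    raises [r] as long as division by [2 ^ r] leaves an even number, and then stays at [v]. *)
Lemma cpt_head G : cpt G -> cpt (fun p x => head 0 (CodeSeq.decode (G p x))).
Proof.
apply: (@cpt_comp1 (fun _ n => head 0 (CodeSeq.decode n))).
apply: (@eq_cpt (fun p x => iteri (x 0) (fun _ r => r + ~~ odd (x 0 %/ 2 ^ r)) 0)).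
  move=> p x; elim/code_ind: (x 0) => s; rewrite CodeSeq.codeK; case: s => [|v s] //.
  set n := CodeSeq.code _.
  have loop m : iteri m (fun _ r => r + ~~ odd (n %/ 2 ^ r)) 0 = minn m v.
    elim: m => [|m /= ->]; first by rewrite min0n.
    have [le_vm|lt_mv] := leqP v m.
      rewrite (minn_idPr (leqW le_vm)) /n /= mulKn ?expn_gt0 //.
      by rewrite /= odd_double addn0.
    rewrite (minn_idPl lt_mv) /n /= -(subnKC lt_mv).
    rewrite addSnnS expnD expnS -!mulnA mulKn ?expn_gt0 // mul2n odd_double.
    by rewrite addn1.
  rewrite loop /=; apply/minn_idPr.
  (* Running the loop as often as the code itself suffices, as [v < 2 ^ v] and [2 ^ v] is at most
     the code. *)
  by rewrite (leq_trans (ltnW (ltn_expl v (ltnSn 1)))) // leq_pmulr.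
apply: cpt_iteri; [exact: cpt_const | | exact: cpt_var].
apply: cpt_add (cpt_var 1) _; apply/cpt_negb/cpt_odd.
exact: cpt_divn_exp2 (cpt_var 2) (cpt_var 1).
Qed.

Lemma cpt_behead G : cpt G ->
  cpt (fun p x => CodeSeq.code (behead (CodeSeq.decode (G p x)))).
Proof.
move=> cG.
(* Dividing by [2 ^ v] leaves the odd factor, and one more halving leaves the code of the tail. The
   empty sequence has code 0, which stays 0. *)
apply: (@eq_cpt (fun p x => G p x %/ 2 ^ (head 0 (CodeSeq.decode (G p x))).+1)).
  move=> p x; elim/code_ind: (G p x) => s; rewrite CodeSeq.codeK; case: s => [|v s] //=.
  by rewrite expnSr divnMA mulKn ?expn_gt0 // divn2 /= uphalf_double.
by apply: cpt_divn_exp2 => //; apply/cpt_succ/cpt_head.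
Qed.

Lemma cpt_drop F G : cpt F -> cpt G ->
  cpt (fun p x => CodeSeq.code (drop (F p x) (CodeSeq.decode (G p x)))).
Proof.
move=> cF cG.
apply: (@eq_cpt (fun p x => iteri (F p x)
    (fun _ r => CodeSeq.code (behead (CodeSeq.decode r))) (G p x))).
  move=> p x; elim/code_ind: (G p x) => s; rewrite CodeSeq.codeK; elim: (F p x) => [|n /= ->].
    by rewrite drop0.
  by rewrite CodeSeq.codeK -drop1 drop_drop.
by apply: cpt_iteri => //; exact: cpt_behead (cpt_var 1).
Qed.

Lemma cpt_nth F G : cpt F -> cpt G ->
  cpt (fun p x => nth 0 (CodeSeq.decode (G p x)) (F p x)).
Proof.
move=> cF cG; apply: eq_cpt (cpt_head (cpt_drop cF cG)) => p x.
by rewrite CodeSeq.codeK -nth0 nth_drop addn0.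
Qed.

(** Only the empty sequence has code 0, so the size is the number of [i] for which dropping [i]
    entries leaves a nonzero code. By [size_le_code] the code itself bounds the search. *)
Lemma cpt_size G : cpt G -> cpt (fun p x => size (CodeSeq.decode (G p x))).
Proof.
apply: (@cpt_comp1 (fun _ n => size (CodeSeq.decode n))).
apply: (@eq_cpt (fun p x => iteri (x 0)
    (fun i r => r + (CodeSeq.code (drop i (CodeSeq.decode (x 0))) != 0)) 0)).
  move=> p x; elim/code_ind: (x 0) => s; rewrite CodeSeq.codeK.
  have loop m : iteri m
      (fun i r => r + (CodeSeq.code (drop i s) != 0)) 0 = minn m (size s).
    elim: m => [|m /= ->]; first by rewrite min0n.
    rewrite code_eq0 -size_eq0 size_drop subn_eq0 -ltnNge.
    have [lt_ms|le_sm] := ltnP m (size s).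
      by rewrite (minn_idPl lt_ms) addn1.
    by rewrite (minn_idPr (leqW le_sm)) addn0.
  by rewrite loop (minn_idPr (size_le_code s)).
apply: cpt_iteri; [exact: cpt_const | | exact: cpt_var].
apply: cpt_add (cpt_var 1) _; apply/cpt_negb/cpt_eqn; last exact: cpt_const.
exact: cpt_drop (cpt_var 0) (cpt_var 2).
Qed.

Ltac prove_cpt := repeat (cbv beta; first
  [ exact: cpt_var | exact: cpt_const | apply: cpt_negb | apply: cpt_and
  | apply: cpt_implyb | apply: cpt_leq | apply: cpt_eqn | apply: cpt_odd
  | apply: cpt_all | apply: cpt_nth | apply: cpt_size | apply: cpt_oracle
  | apply: cpt_succ | apply: cpt_sub | apply: cpt_double | apply: cpt_half
  | apply: cpt_mul | apply: cpt_exp2 ]).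

(** * The reductions *)

(** A realizer of [problem_of g] has only one correct answer at [z], so total maps [H] and [K] that
    are correct on names give the reduction. [K] sees the answer alone, as the strong form
    demands. *)
Lemma le_sW_problem_of (X Y Z W : repSpace) (f : X -> Y) (g : Z -> W)
    (H K : baire -> baire) :
  cpt (fun p x => H p (x 0)) -> cpt (fun p x => K p (x 0)) ->
  (forall p x, names p x -> exists2 z, names (H p) z &
     forall q, names q (g z) -> names (K q) (f x)) ->
  le_sW (problem_of f) (problem_of g).
Proof.
move=> /cpt_computable cH /cpt_computable cK red.
exists (fun p => Some (H p)), (fun q => Some (K q)); split=> // G rG p x px _.
have [z Hz Kz] := red p x px.
have [q [Gq [y qy yE]]] := rG _ _ Hz (ex_intro _ _ erefl : pdom (problem_of g) z).
exists (K q); split; first by rewrite /pcomp /= Gq.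
by exists (f x); last by []; apply: Kz; rewrite -(yE : y = g z).
Qed.

Lemma le_sW_refl (X Y : repSpace) (f : X -> Y) :
  le_sW (problem_of f) (problem_of f).
Proof.
apply: (@le_sW_problem_of _ _ _ _ _ _ id id); [by prove_cpt | by prove_cpt |].
by move=> p x px; exists x.
Qed.

Lemma infinite_natP (S : set nat) :
  infinite_set S <-> forall n, exists2 v, S v & n <= v.
Proof.
split=> [infS n|unbS].
  apply: contrapT => nex; apply: infS; apply: sub_finite_set (finite_II n) => v Sv.
  by rewrite /= ltnNge; apply/negP => le_nv; apply: nex; exists v.
move=> /finite_seqP[s eqS]; have [v] := unbS (\max_(u <- s) u).+1.
by rewrite eqS /= ltnNge => sv; rewrite (@leq_bigmax_seq _ s xpredT id v sv).
Qed.

(** * Color classes and independent sets *)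

Definition infinite_indep (G : graph) : Prop :=
  exists S : set nat, [/\ infinite_set S, S `<=` [set v | vert G v]
    & forall u v, S u -> S v -> u <> v -> ~~ edge G u v].

Definition infinite_path (T : tree) : Prop :=
  exists f : nat -> nat, forall n, node T (mkseq f n).

Lemma infinite_color_class G :
  (exists2 c, coloring G c & exists k, infinite_set [set v | vert G v /\ c v = k])
  <-> infinite_indep G.
Proof.
split=> [[c col [k infk]]|[S [infS SV indS]]].
  exists [set v | vert G v /\ c v = k]; split=> // [v []//|u v [_ cu] [_ cv] _].
  by apply/negP => /col; rewrite cu cv.
(* The successor reserves color 0 for [S]. *)
exists (fun v => if `[< S v >] then 0 else v.+1).
  move=> u v uv; have ne_uv : u <> v by move=> eq_uv; rewrite eq_uv edge_irr in uv.
  case: asboolP => Su; case: asboolP => Sv //; last by case.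
  by move: (indS u v Su Sv ne_uv); rewrite uv.
exists 0; apply: sub_infinite_set infS => v Sv; split; first exact: SV.
by rewrite asboolT.
Qed.

Lemma RC_eq_D : RC = D.
Proof.
congr problem_of; apply/funext => G; apply: asbool_equiv_eq.
exact: infinite_color_class.
Qed.

(** * From graphs to trees *)

(** The increasing order makes every infinite path injective, so that its range is infinite. *)
Definition indep_seq (G : graph) (s : seq nat) : bool :=
  all (vert G) s && pairwise (fun u v => (u < v) && ~~ edge G u v) s.

Lemma indep_seq_prefix G s t : prefix s t -> indep_seq G t -> indep_seq G s.
Proof.
move=> /prefixP[s' ->]; rewrite /indep_seq all_cat pairwise_cat.
by move=> /andP[/andP[-> _] /and3P[_ -> _]].
Qed.

Definition indep_tree (G : graph) : tree := Tree (@indep_seq_prefix G).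

Lemma all_iotaS (P : pred nat) n :
  all P (iota 0 n.+1) = all P (iota 0 n) && P n.
Proof. by rewrite -addn1 iotaD all_cat /= andbT. Qed.

(** Bounded quantifiers over positions serve both the path argument and [cpt_all]. *)
Lemma indep_mkseq G f n : indep_seq G (mkseq f n) =
  all (fun j => vert G (f j) &&
    all (fun i => (f i < f j) && ~~ edge G (f i) (f j)) (iota 0 j)) (iota 0 n).
Proof.
elim: n => // n IH; rewrite all_iotaS -IH mkseqS /indep_seq all_rcons pairwise_rcons.
by rewrite andbACA [LHS]andbC; congr (_ && (_ && _)); exact: all_map.
Qed.

Lemma infinite_path_indep_tree G : infinite_path (indep_tree G) <-> infinite_indep G.
Proof.
split=> [[f fT]|[S [/infinite_natP infS SV indS]]].
  have fP j : vert G (f j) /\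
      forall i, i < j -> f i < f j /\ ~~ edge G (f i) (f j).
    have /= := fT j.+1; rewrite indep_mkseq all_iotaS => /andP[_ /andP[-> /allP fj]].
    by split=> // i ltij; apply/andP/fj; rewrite mem_iota.
  have le_f n : n <= f n.
    by elim: n => // n IH; apply: leq_ltn_trans IH _; case: (fP n.+1) => _ /(_ n)[].
  exists (range f); split=> [|_ [i _ <-]|_ _ [i _ <-] [j _ <-] ne_ij].
  - by apply/infinite_natP => n; exists (f n); first by exists n.
  - by case: (fP i).
  - have [ltij|ltji|eq_ij] := ltngtP i j; last by rewrite eq_ij in ne_ij.
      by case: (fP j) => _ /(_ i ltij)[].
    by rewrite edge_sym; case: (fP i) => _ /(_ j ltji)[].
have /choice[g gP] : forall n, exists v, S v /\ n < v.
  by move=> n; have [v Sv ltnv] := infS n.+1; exists v.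
(* The first value is [g 0], since 0 itself need not lie in [S]. *)
pose f n := iter n.+1 g 0.
have Sf n : S (f n) by case: (gP (iter n g 0)).
have f_mono : {homo f : i j / i < j}.
  by apply: homo_ltn => [j i k|n]; [exact: ltn_trans | case: (gP (f n))].
exists f => n /=; rewrite indep_mkseq; apply/allP => j _.
apply/andP; split; first exact: SV.
apply/allP => i; rewrite mem_iota => /f_mono lt_f; rewrite lt_f.
by apply: indS => // eq_f; rewrite eq_f ltnn in lt_f.
Qed.

Lemma D_le_WF : le_sW D WF.
Proof.
(* This is the test of [indep_mkseq] for the sequence coded by [n], with the graph queried through
   [p]. The product of powers of 2 is the code of a pair, unfolded. *)
pose H (p : baire) n : nat := all (fun j =>
    (p (nth 0 (CodeSeq.decode n) j).*2 != 0) &&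
    all (fun i =>
      (nth 0 (CodeSeq.decode n) i < nth 0 (CodeSeq.decode n) j) &&
      (p (2 ^ nth 0 (CodeSeq.decode n) i *
          (2 ^ nth 0 (CodeSeq.decode n) j * 1).*2.+1).*2.+1 == 0)) (iota 0 j))
  (iota 0 (size (CodeSeq.decode n))).
(* The answer is negated because [WF] outputs 1 when there is no path. *)
apply: (@le_sW_problem_of _ _ _ _ _ _ H (fun q _ => 1 - q 0)).
- by rewrite /H; prove_cpt.
- by prove_cpt.
move=> p G [pV pE]; exists (indep_tree G).
  move=> s /=; rewrite /H CodeSeq.codeK -[in RHS](mkseq_nth 0 s) indep_mkseq.
  congr nat_of_bool; apply: eq_all => j; rewrite pV eqb0 negbK; congr andb.
  apply: eq_all => i; congr andb; rewrite -eqb0.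
  exact: (congr1 (eq_op^~ 0) (pE _ _)).
move=> q; rewrite /= /bool_names => ->.
rewrite (asbool_equiv_eq (infinite_path_indep_tree G)).
by case: `[< _ >].
Qed.

(** * From trees to graphs *)

Definition comparable (s t : seq nat) : bool := prefix s t || prefix t s.

(** If no common position separates two sequences, the shorter is an initial segment of the longer.
    This turns comparability into a bounded, hence computable, check. *)
Lemma comparableE s t : comparable s t =
  all (fun i => (i < size t) ==> (nth 0 s i == nth 0 t i)) (iota 0 (size s)).
Proof.
apply/idP/allP => [|eq_st].
  case/orP=> /prefixP[r ->] i; rewrite mem_iota nth_cat => /= lt_i.
    by rewrite lt_i eqxx implybT.
  by apply/implyP => ->.
have nth_st i : i < size s -> i < size t -> nth 0 s i = nth 0 t i.
  by move=> lt_is lt_it; apply/eqP; move: lt_it; apply/implyP/eq_st; rewrite mem_iota.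
apply/orP; rewrite !prefixE; have [le_st|/ltnW le_ts] := leqP (size s) (size t).
  left; apply/eqP/(@eq_from_nth _ 0); rewrite size_takel // => i lt_i.
  by rewrite nth_take // nth_st // (leq_trans lt_i).
right; apply/eqP/(@eq_from_nth _ 0); rewrite size_takel // => i lt_i.
by rewrite nth_take // nth_st // (leq_trans lt_i).
Qed.

Definition node_vert (T : tree) : pred nat := fun v => node T (CodeSeq.decode v).

Definition incomparable_edge (T : tree) : rel nat := fun u v =>
  [&& node_vert T u, node_vert T v
    & ~~ comparable (CodeSeq.decode u) (CodeSeq.decode v)].

Lemma incomparable_edge_vert T u v :
  incomparable_edge T u v -> node_vert T u && node_vert T v.
Proof. by move=> /and3P[-> ->]. Qed.

Lemma incomparable_edge_sym T : symmetric (incomparable_edge T).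
Proof. by move=> u v; rewrite /incomparable_edge andbCA /comparable orbC. Qed.

Lemma incomparable_edge_irr T : irreflexive (incomparable_edge T).
Proof. by move=> u; rewrite /incomparable_edge /comparable prefix_refl !andbF. Qed.

Definition incomparability_graph (T : tree) : graph :=
  Graph (@incomparable_edge_vert T) (@incomparable_edge_sym T)
    (@incomparable_edge_irr T).

Lemma infinite_indep_incomparability_graph T :
  infinite_indep (incomparability_graph T) <-> infinite_path T.
Proof.
split=> [[S [infS ST chainS]]|[f fT]].
  have compS u v : S u -> S v -> comparable (CodeSeq.decode u) (CodeSeq.decode v).
    move=> Su Sv; have [->|/eqP ne_uv] := eqVneq u v.
      by rewrite /comparable prefix_refl.
    have := chainS u v Su Sv ne_uv; rewrite /= /incomparable_edge.
    by rewrite (ST u Su : node_vert T u) (ST v Sv : node_vert T v) negbK.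
  have nthS u v i : S u -> S v -> i < size (CodeSeq.decode u) ->
      i < size (CodeSeq.decode v) ->
      nth 0 (CodeSeq.decode u) i = nth 0 (CodeSeq.decode v) i.
    move=> Su Sv lt_u lt_v; have := compS u v Su Sv; rewrite comparableE => /allP.
    by move=> /(_ i); rewrite mem_iota lt_v => /(_ lt_u)/eqP.
  have /choice[g gP] : forall n, exists v, S v /\ n < size (CodeSeq.decode v).
    move=> n; apply: contrapT => nex; apply: infS.
    (* Comparable nodes of equal length coincide, so a bound on the lengths would make [S]
       finite. *)
    have inj_sz : {in S &, injective (size \o CodeSeq.decode)}.
      move=> u v /set_mem Su /set_mem Sv /= eq_sz.
      apply: (can_inj CodeSeq.decodeK); apply: (@eq_from_nth _ 0) => // i lt_i.
      by apply: nthS => //; rewrite -eq_sz.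
    rewrite -(eq_finite_set (inj_card_eq inj_sz)).
    apply: sub_finite_set (finite_II n.+1) => _ [v Sv <-]; rewrite /= ltnS leqNgt.
    by apply/negP => lt_n; apply: nex; exists v.
  (* By [nthS] any member of [S] longer than [n] has the same entry at [n], so [mkseq f n] is an
     initial segment of the node [g n]. *)
  pose f n := nth 0 (CodeSeq.decode (g n)) n.
  exists f => n; have [Sgn lt_n] := gP n.
  have -> : mkseq f n = take n (CodeSeq.decode (g n)).
    apply: (@eq_from_nth _ 0) => [|i]; rewrite size_mkseq.
      by rewrite size_takel // ltnW.
    move=> lt_i.
    have [Sgi lt_gi] := gP i; rewrite nth_mkseq // nth_take //.
    by apply: nthS => //; exact: ltn_trans lt_n.
  exact: node_prefix (prefix_take _ _) (ST _ Sgn).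
have prefix_mkseq i j : i <= j -> prefix (mkseq f i) (mkseq f j).
  by move=> /minn_idPl le_ij; rewrite -le_ij /mkseq -take_iota map_take prefix_take.
exists (range (fun n => CodeSeq.code (mkseq f n))); split.
- apply/infinite_natP => n; exists (CodeSeq.code (mkseq f n)); first by exists n.
  (* A code is at least the length of its sequence, so these codes are unbounded. *)
  by rewrite -{1}(size_mkseq f n) size_le_code.
- by move=> _ [n _ <-]; rewrite /= /node_vert CodeSeq.codeK.
- move=> _ _ [i _ <-] [j _ <-] _; rewrite /= /incomparable_edge !CodeSeq.codeK.
  rewrite /comparable; have [le_ij|/ltnW le_ji] := leqP i j.
    by rewrite prefix_mkseq // !andbF.
  by rewrite [X in _ || X]prefix_mkseq // orbT !andbF.
Qed.

Lemma WF_le_D : le_sW WF D.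
Proof.
pose fst n := nth 0 (CodeSeq.decode n./2) 0.
pose snd n := nth 0 (CodeSeq.decode n./2) 1.
(* The two implications split by parity: even places describe vertices, odd places edges. The last
   conjunct negates the check of [comparableE] on the two coded nodes. *)
pose H (p : baire) n : nat :=
  (~~ odd n ==> (p n./2 != 0)) &&
  (odd n ==> (p (fst n) != 0) && ((p (snd n) != 0) &&
    ~~ all (fun i => (i < size (CodeSeq.decode (snd n))) ==>
        (nth 0 (CodeSeq.decode (fst n)) i == nth 0 (CodeSeq.decode (snd n)) i))
      (iota 0 (size (CodeSeq.decode (fst n)))))).
apply: (@le_sW_problem_of _ _ _ _ _ _ H (fun q _ => 1 - q 0)).
- by rewrite /H /fst /snd; prove_cpt.
- by prove_cpt.
move=> p T pT; exists (incomparability_graph T).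
  have pV v : p v = node_vert T v by rewrite -pT CodeSeq.decodeK.
  split=> [v|u v].
    by rewrite /H odd_double doubleK pV eqb0 negbK andbT.
  rewrite /H /fst /snd oddS odd_double (half_bit_double _ true) CodeSeq.codeK.
  by rewrite !pV !eqb0 !(negbK (node_vert _ _)) -comparableE.
move=> q; rewrite /= /bool_names => ->.
rewrite (asbool_equiv_eq (infinite_indep_incomparability_graph T)).
by case: `[< _ >].
Qed.

Theorem theorem29 : equiv_sW RC D /\ equiv_sW D WF.
Proof.
split; last by split; [exact: D_le_WF | exact: WF_le_D].
by rewrite RC_eq_D; split; exact: le_sW_refl.
Qed.
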